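(* Let $(\mathcal{L},\circ_\lambda,\ast_\lambda)$ be a pre-Lie Poisson conformal algebra. Define $$[a_\lambda b]=a\ast_\lambda b-b\ast_{-\partial-\lambda}a,\qquad a,b\in\mathcal{L}.$$ Then $(\mathcal{L},\circ_\lambda,[\cdot_\lambda\cdot])$ is a transposed Poisson conformal algebra.
   Context: All vector spaces, linear maps and tensor products are over $\mathbb{C}$. For a vector space $A$, $A[\lambda]$ denotes polynomials in $\lambda$ with coefficients in $A$. A conformal algebra $(A,\circ_\lambda)$ is a $\mathbb{C}[\partial]$-module $A$ with a $\mathbb{C}$-bilinear map $A\otimes A\to A[\lambda]$, $a\otimes b\mapsto a\circ_\lambda b$, such that $(\partial a)\circ_\lambda b=-\lambda\, a\circ_\lambda b$ and $a\circ_\lambda(\partial b)=(\partial+\lambda)(a\circ_\lambda b)$. Convention: products are extended linearly to polynomials in formal variables. If $a\circ_\lambda b=\sum_n\lambda^n w_n$ and $\nu$ is a linear combination of formal variables, then $a\circ_{-\partial+\nu}b=\sum_n(-\partial+\nu)^n w_n$; the same convention applies to $\ast_\lambda$ and $[\cdot_\lambda\cdot]$. A commutative associative conformal algebra is a conformal algebra with $a\circ_\lambda(b\circ_\mu c)=(a\circ_\lambda b)\circ_{\lambda+\mu}c$ and $a\circ_\lambda b=b\circ_{-\partial-\lambda}a$ for all $a,b,c$. A Lie conformal algebra $(A,[\cdot_\lambda\cdot])$ is a conformal algebra (with product written $[a_\lambda b]$) such that $[a_\lambda b]=-[b_{-\lambda-\partial}a]$ and $[a_\lambda[b_\mu c]]=[[a_\lambda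 b]_{\lambda+\mu}c]+[b_\mu[a_\lambda c]]$ for all $a,b,c$. A left-symmetric conformal algebra $(A,\ast_\lambda)$ is a conformal algebra with $(a\ast_\lambda b)\ast_{\lambda+\mu}c-a\ast_\lambda(b\ast_\mu c)=(b\ast_\mu a)\ast_{\lambda+\mu}c-b\ast_\mu(a\ast_\lambda c)$ for all $a,b,c$. A pre-Lie Poisson conformal algebra $(\mathcal{L},\circ_\lambda,\ast_\lambda)$ is a $\mathbb{C}[\partial]$-module $\mathcal{L}$ such that $(\mathcal{L},\circ_\lambda)$ is a commutative associative conformal algebra, $(\mathcal{L},\ast_\lambda)$ is a left-symmetric conformal algebra, and for all $a,b,c\in\mathcal{L}$: $(a\circ_\lambda b)\ast_{\lambda+\mu}c=a\circ_\lambda(b\ast_\mu c)$ and $(a\ast_\lambda b)\circ_{\lambda+\mu}c-a\ast_\lambda(b\circ_\mu c)=(b\ast_\mu a)\circ_{\lambda+\mu}c-b\ast_\mu(a\circ_\lambda c)$. A transposed Poisson conformal algebra (TPCA) is a $\mathbb{C}[\partial]$-module $\mathcal{L}$ with $\mathbb{C}$-bilinear maps $\circ_\lambda,[\cdot_\lambda\cdot]:\mathcal{L}\otimes\mathcal{L}\to\mathcal{L}[\lambda]$ such that $(\mathcal{L},\circ_\lambda)$ is a commutative associative conformal algebra, $(\mathcal{L},[\cdot_\lambda\cdot])$ is a Lie conformal algebra, and $2(a\circ_\lambda[b_\mu c])=[(a\circ_\lambda b)_{\lambda+\mu}c]+[b_\mu(a\circ_\lambda c)]$ for all $a,b,c\in\mathcal{L}$.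 *)

(* Defs.v *)
From HB Require Import structures.
From mathcomp Require Import all_boot all_order all_algebra finmap.
From mathcomp Require Import monalg reals complex.

Set Implicit Arguments.
Unset Strict Implicit.
Unset Printing Implicit Defensive.

Import GRing.Theory.
Local Open Scope ring_scope.

(* [{pmod V}] is V[x], the polynomials in one variable x with coefficients in
   an additive group V: the finitely supported maps [nat -> V], with [p@_n]
   the coefficient of x^n. If V is a module over a ring S, then V[x] is a
   module over S[x] = [{poly S}], in which ['X] multiplies by x and [s%:P]
   acts by s on every coefficient. *)
Definition pmod (V : zmodType) : Type := {malg V[nat]}.

Notation "{ 'pmod' V }" := (pmod V) (at level 0, format "{ 'pmod'  V }").

HB.instance Definition _ (V : zmodType) := GRing.Zmodule.on {pmod V}.

Definition pmodC (V : zmodType) (v : V) : {pmod V} := << v *g 0%N >>.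

Section PmodScale.
Variables (S : nzRingType) (V : lmodType S).
Implicit Types (p q : {poly S}) (u v : {pmod V}).

Definition pscale p u : {pmod V} :=
  \sum_(i < size p) \sum_(n <- msupp u) << p`_i *: u@_n *g (i + n)%N >>.

Lemma pscaleE p u n :
  (pscale p u)@_n = \sum_(i < n.+1) p`_i *: u@_(n - i)%N.
Proof.
rewrite /pscale raddf_sum /=.
pose F i := if (i <= n)%N then p`_i *: u@_(n - i)%N else 0.
rewrite (eq_bigr (fun i : 'I_(size p) => F i)); last first.
  move=> i _; rewrite raddf_sum /= /F.
  rewrite (eq_bigr (fun m => if (i + m == n)%N then p`_i *: u@_m else 0));
    last first.
    by move=> m _; rewrite mcoeffU; case: eqP.
  case: leqP => [le_in|lt_ni]; last first.
    apply: big1 => m _; case: eqP => // eq_n.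
    by move: lt_ni; rewrite -eq_n ltnNge leq_addr.
  rewrite (eq_bigr (fun m => if (m == n - i)%N then p`_i *: u@_m else 0));
    last first.
    by move=> m _; rewrite -(eqn_add2l i m) subnKC.
  rewrite -big_mkcond /=; case: (boolP ((n - i)%N \in msupp u)) => [hin|hout].
    rewrite (big_rem (n - i)%N) //= eqxx big1_seq ?addr0 // => m /andP[/eqP->].
    by rewrite mem_rem_uniq ?fset_uniq // inE eqxx.
  rewrite (mcoeff_outdom hout) scaler0 big1_seq // => m /andP[/eqP-> hm].
  by case/negP: hout.
rewrite (eq_bigr (fun i : 'I_n.+1 => F i)); last first.
  by move=> i _; rewrite /F -ltnS ltn_ord.
rewrite -!(big_mkord xpredT F).
have F0 k : (size p <= k)%N || (n < k)%N -> F k = 0.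
  rewrite /F; case/orP => [/(nth_default 0) ->|]; first by rewrite scale0r if_same.
  by rewrite ltnNge => /negPf->.
have wide m : (minn (size p) n.+1 <= m)%N ->
    \sum_(0 <= i < m) F i = \sum_(0 <= i < minn (size p) n.+1) F i.
  move=> le_m; rewrite (big_cat_nat (leq0n _) le_m) /=.
  rewrite [X in _ + X]big_nat_cond [X in _ + X]big1 ?addr0 // => i.
  by rewrite andbT => /andP[+ _]; rewrite geq_min => /F0.
by rewrite !wide ?geq_minr ?geq_minl.
Qed.

Lemma pscaleA p q u : pscale p (pscale q u) = pscale (p * q) u.
Proof.
apply/malgP => n; rewrite !pscaleE.
rewrite (eq_bigr (fun i : 'I_n.+1 =>
    \sum_(j < n.+1 | (i + j <= n)%N) p`_i *: (q`_j *: u@_(n - (i + j))%N))).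
  rewrite [RHS](eq_bigr (fun k : 'I_n.+1 =>
      \sum_(i < n.+1 | (i <= k)%N) p`_i *: (q`_(k - i)%N *: u@_(n - k)%N))).
    rewrite [RHS](exchange_big_dep xpredT) //=; apply: eq_bigr => i _.
    rewrite -[LHS](big_mkord (fun j => (i + j <= n)%N)
      (fun j => p`_i *: (q`_j *: u@_(n - (i + j))%N))).
    rewrite -[RHS](big_mkord (fun k => (i <= k)%N)
      (fun k => p`_i *: (q`_(k - i)%N *: u@_(n - k)%N))).
    have le_i : (i <= n.+1)%N by apply: ltnW.
    rewrite [RHS](big_cat_nat (leq0n _) le_i) /=.
    rewrite [X in _ = X + _]big_nat_cond [X in _ = X + _]big1 ?add0r; last first.
      by move=> k /andP[/andP[_ lt_ki]]; rewrite leqNgt lt_ki.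
    have le_s : (n.+1 - i <= n.+1)%N by apply: leq_subr.
    rewrite [LHS](big_cat_nat (leq0n _) le_s) /=.
    rewrite [X in _ + X = _]big_nat_cond [X in _ + X = _]big1 ?addr0; last first.
      move=> k /andP[/andP[le_k _]]; rewrite leqNgt.
      by rewrite leq_subLR in le_k; rewrite le_k.
    have shift (m : nat) (P : pred nat) (F : nat -> V) :
        \sum_(m <= k < n.+1 | P k) F k
        = \sum_(0 <= k < n.+1 - m | P (k + m)%N) F (k + m)%N.
      by rewrite -{1}[m]add0n big_addn.
    rewrite shift [LHS]big_nat_cond [RHS]big_nat_cond.
    apply: eq_big => [k|k _]; last by rewrite addnK addnC.
    rewrite leq_addl andbT; case: ltnP => lt_k; rewrite ?andbF //=.
    by move: lt_k; rewrite ltn_subRL ltnS.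
  move=> k _; rewrite coefM scaler_suml.
  rewrite (eq_bigr (fun j : 'I_k.+1 => p`_j *: (q`_(k - j)%N *: u@_(n - k)%N)));
    last by move=> j _; rewrite scalerA.
  rewrite (big_ord_widen_cond n.+1 xpredT
    (fun j => p`_j *: (q`_(k - j)%N *: u@_(n - k)%N))) //.
move=> i _; rewrite pscaleE scaler_sumr.
rewrite (eq_bigr (fun j : 'I_(n - i).+1 => p`_i *: (q`_j *: u@_(n - (i + j))%N)));
  last by move=> j _; rewrite subnDA.
rewrite (big_ord_widen_cond n.+1 xpredT
  (fun j => p`_i *: (q`_j *: u@_(n - (i + j))%N))); last by rewrite ltnS leq_subr.
apply: eq_bigl => j /=; rewrite ltnS leq_subRL //.
by rewrite -ltnS.
Qed.

Lemma pscale1 : left_id 1 pscale.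
Proof.
move=> u; apply/malgP => n; rewrite pscaleE big_ord_recl coef1 scale1r subn0.
by rewrite big1 ?addr0 // => i _; rewrite coef1 scale0r.
Qed.

Lemma pscaleDr : right_distributive pscale +%R.
Proof.
move=> p u v; apply/malgP => n; rewrite mcoeffD !pscaleE -big_split /=.
by apply: eq_bigr => i _; rewrite mcoeffD scalerDr.
Qed.

Lemma pscaleDl u : {morph pscale^~ u : p q / p + q}.
Proof.
move=> p q; apply/malgP => n; rewrite mcoeffD !pscaleE -big_split /=.
by apply: eq_bigr => i _; rewrite coefD scalerDl.
Qed.

HB.instance Definition _ := GRing.Zmodule_isLmodule.Build {poly S} {pmod V}
  pscaleA pscale1 pscaleDr pscaleDl.

End PmodScale.

(* The value at nu of p = \sum_n x^n v_n, for nu in a ring acting on M, after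
   each v_n has been sent to M by iota. *)
Definition peval (V : zmodType) (T : nzRingType) (M : lmodType T)
    (iota : V -> M) (nu : T) (p : {pmod V}) : M :=
  \sum_(n <- msupp p) nu ^+ n *: iota p@_n.

(* C[d]-modules are modules over [{poly R[i]}], with d acting as ['X].
   Then A[l] = [{pmod A}] is a module over C[d][l], and
   A[l,m] = [{pmod {pmod A}}] is a module over C[d][l][m], with l the inner
   and m the outer variable. *)
Section Conformal.
Variable R : realType.

Notation C := R[i].
Notation Cd := {poly C}.
Notation Cdl := {poly Cd}.
Notation Cdlm := {poly Cdl}.

Definition d0 : Cd := 'X.
Definition d1 : Cdl := d0%:P.
Definition l1 : Cdl := 'X.
Definition l2 : Cdlm := l1%:P.
Definition m2 : Cdlm := 'X.

Variable A : lmodType Cd.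
Implicit Types f g : A -> A -> {pmod A}.

Definition const1 (a : A) : {pmod A} := pmodC a.
Definition const2 (a : A) : {pmod {pmod A}} := pmodC (pmodC a).

(* a f_nu b in A[l], resp. in A[l,m]. *)
Definition prod1 f (nu : Cdl) a b : {pmod A} := peval const1 nu (f a b).
Definition prod2 f (nu : Cdlm) a b : {pmod {pmod A}} := peval const2 nu (f a b).

(* (a f_nu b) g_rho c: if a f_l b = \sum_n l^n w_n, this is
   \sum_n nu^n (w_n g_rho c). *)
Definition prodl f (nu : Cdlm) g (rho : Cdlm) a b c : {pmod {pmod A}} :=
  peval (fun w => prod2 g rho w c) nu (f a b).

(* a f_nu (b g_rho c): if b g_l c = \sum_n l^n w_n, this is
   \sum_n rho^n (a f_nu w_n). *)
Definition prodr f (nu : Cdlm) g (rho : Cdlm) a b c : {pmod {pmod A}} :=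
  peval (fun w => prod2 f nu a w) rho (g b c).

Record conformal_algebra f : Prop := ConformalAlgebra {
  conf_linearl : forall (k : C) a a' b,
    f (k%:P *: a + a') b = k%:P%:P *: f a b + f a' b;
  conf_linearr : forall (k : C) a b b',
    f a (k%:P *: b + b') = k%:P%:P *: f a b + f a b';
  conf_derivl : forall a b, f (d0 *: a) b = - (l1 *: f a b);
  conf_derivr : forall a b, f a (d0 *: b) = (d1 + l1) *: f a b }.

Record comm_assoc_conformal_algebra f : Prop := CommAssocConformalAlgebra {
  ca_conformal : conformal_algebra f;
  ca_assoc : forall a b c,
    prodr f l2 f m2 a b c = prodl f l2 f (l2 + m2) a b c;
  ca_comm : forall a b, f a b = prod1 f (- d1 - l1) b a }.

Record lie_conformal_algebra f : Prop := LieConformalAlgebra {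
  lie_conformal : conformal_algebra f;
  lie_skew : forall a b, f a b = - prod1 f (- l1 - d1) b a;
  lie_jacobi : forall a b c,
    prodr f l2 f m2 a b c =
      prodl f l2 f (l2 + m2) a b c + prodr f m2 f l2 b a c }.

Record left_symmetric_conformal_algebra f : Prop :=
  LeftSymmetricConformalAlgebra {
  ls_conformal : conformal_algebra f;
  ls_leftsym : forall a b c,
    prodl f l2 f (l2 + m2) a b c - prodr f l2 f m2 a b c =
      prodl f m2 f (l2 + m2) b a c - prodr f m2 f l2 b a c }.

Record preLie_Poisson_conformal_algebra f g : Prop :=
  PreLiePoissonConformalAlgebra {
  plp_comm_assoc : comm_assoc_conformal_algebra f;
  plp_left_symmetric : left_symmetric_conformal_algebra g;
  plp_mixed : forall a b c,
    prodl f l2 g (l2 + m2) a b c = prodr f l2 g m2 a b c;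
  plp_compat : forall a b c,
    prodl g l2 f (l2 + m2) a b c - prodr g l2 f m2 a b c =
      prodl g m2 f (l2 + m2) b a c - prodr g m2 f l2 b a c }.

Record transposed_Poisson_conformal_algebra f g : Prop :=
  TransposedPoissonConformalAlgebra {
  tp_comm_assoc : comm_assoc_conformal_algebra f;
  tp_lie : lie_conformal_algebra g;
  tp_compat : forall a b c,
    prodr f l2 g m2 a b c *+ 2 =
      prodl f l2 g (l2 + m2) a b c + prodr g m2 f l2 b a c }.

Definition commutator g a b : {pmod A} := g a b - prod1 g (- d1 - l1) b a.

End Conformal.

(* Main.v *)
Require Import Defs.
From HB Require Import structures.
From mathcomp Require Import all_boot all_order all_algebra.
From mathcomp Require Import reals complex.
From mathcomp Require Import finmap monalg ring.

Set Implicit Arguments.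
Unset Strict Implicit.
Unset Printing Implicit Defensive.

(** Write k = - d - l - m, attach the parameters l, m, k to the three arguments
    a, b, c, and let every binary product take the parameter attached to its
    left argument, a product of two arguments carrying the sum of their
    parameters.  In this bookkeeping conformal identities look like ordinary
    ones: replacing a product by its opposite a, b |-> b_(- d - l) a just
    exchanges its two arguments, wherever the product sits in a composite
    (lemmas [prodr_commutator_inner] to [prodr_comm_inner]), because d acts on
    a value of a product of two arguments in the way prescribed by
    sesquilinearity.  Moreover the axioms, stated for the formal parameters l
    and m, hold for all values of these in C[d][l][m]
    ([leftsym_subst], [mixed_subst]); hence they hold for every permutation of
    a, b, c, each argument keeping its parameter.

    The classical computations then apply.  With associator
    (a,b,c) = (a*b)*c - a*(b*c), the Jacobi identity of the commutator is the
    sum of the left-symmetry relations (a,b,c) = (b,a,c), (a,c,b) = (c,a,b) and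
    (b,c,a) = (c,b,a) with suitable signs ([associator_cancel]).  For the
    compatibility of the commutator with the commutative product o, the axiom
    (a o b)*c = a o (b*c) reduces the identity to
    a o (b*c) - a o (c*b) = b*(a o c) - c*(a o b), which, o being commutative,
    is the axiom (b*c) o a - b*(c o a) = (c*b) o a - c*(b o a)
    ([double_cancel]). *)

Import GRing.Theory.
Local Open Scope ring_scope.

(** * Additive maps and polynomials with coefficients in a module *)

Section Monomials.
Variables (S : nzRingType) (V : lmodType S).

Lemma pmod_scaleE (p : {poly S}) (u : {pmod V}) n :
  (p *: u)@_n = \sum_(i < n.+1) p`_i *: u@_(n - i)%N.
Proof. exact: pscaleE. Qed.

Lemma pmod_scaleC (s : S) (v : V) n :
  s%:P *: (<< v *g n >> : {pmod V}) = << s *: v *g n >>.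
Proof.
apply/malgP => m; rewrite pmod_scaleE big_ord_recl coefC eqxx subn0.
rewrite big1 ?addr0 => [|i _]; last by rewrite coefC scale0r.
by rewrite !mcoeffU scalerMnr.
Qed.

Lemma pmod_scaleX (v : V) n :
  'X *: (<< v *g n >> : {pmod V}) = << v *g n.+1 >>.
Proof.
apply/malgP => m; rewrite pmod_scaleE big_ord_recl coefX scale0r add0r.
rewrite mcoeffU; case: m => [|m]; first by rewrite big_ord0.
rewrite big_ord_recl coefX scale1r big1 ?addr0 => [|i _].
  by rewrite mcoeffU subSS subn0 eqSS.
by rewrite coefX scale0r.
Qed.

Lemma pmod_scaleXn (v : V) n :
  'X^n *: (pmodC v : {pmod V}) = << v *g n >>.
Proof.
elim: n => [|n IHn]; first by rewrite expr0 scale1r.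
by rewrite exprS -scalerA IHn pmod_scaleX.
Qed.

End Monomials.

Section ZmodMorphism.
Variables (V W : zmodType) (F : V -> W).
Hypothesis FB : zmod_morphism F.

Let FA : {additive V -> W} :=
  HB.pack F (GRing.isZmodMorphism.Build V W F FB).

Lemma zmod_morphismN : {morph F : x / - x}.
Proof. exact: (raddfN FA). Qed.

Lemma zmod_morphismD : {morph F : x y / x + y}.
Proof. exact: (raddfD FA). Qed.

Lemma zmod_morphism_sum I (r : seq I) (E : I -> V) :
  F (\sum_(i <- r) E i) = \sum_(i <- r) F (E i).
Proof. exact: (raddf_sum FA). Qed.

End ZmodMorphism.

Lemma subr_swap (V : zmodType) (x y z w : V) : x - y = z - w -> x - z = y - w.
Proof.
move/eqP; rewrite subr_eq => /eqP->.
by rewrite addrAC [z - w]addrC addrK addrC.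
Qed.

(** The last step of the compatibility: with the arguments permuted,
    [x = a o (b*c)], [z = a o (c*b)], [y = b*(a o c)] and [w = c*(a o b)]. *)
Lemma double_cancel (V : zmodType) (x y z w : V) :
  x - y = z - w -> (x - z) *+ 2 = x - w + (y - z).
Proof.
move/subr_swap=> E; rewrite mulr2n {2}E addrACA [RHS]addrACA.
by congr (_ + _); rewrite addrC.
Qed.

(** The last step of the Jacobi identity: [l_abc] stands for [(a*b)*c] and
    [r_abc] for [a*(b*c)], and similarly for the other permutations. *)
Lemma associator_cancel (V : zmodType)
    (l_abc r_abc l_bac r_bac l_acb r_acb : V)
    (l_cab r_cab l_bca r_bca l_cba r_cba : V) :
  l_abc - r_abc = l_bac - r_bac ->
  l_acb - r_acb = l_cab - r_cab ->
  l_bca - r_bca = l_cba - r_cba ->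
  r_abc - r_acb - (l_bca - l_cba) =
    l_abc - l_bac - (r_cab - r_cba) + (r_bac - r_bca - (l_acb - l_cab)).
Proof.
move=> /subr_swap-> /subr_swap-> /subr_swap->.
rewrite !opprB [RHS]addrACA !subrKA.
by rewrite -!addrA; congr (_ + _); rewrite addrCA [RHS]addrCA [- _ - _]addrC.
Qed.

(** * Evaluation of polynomials with coefficients in a module *)

Section Evaluation.
Variables (V : zmodType) (T : comNzRingType) (M : lmodType T).
Variables (iota : V -> M) (nu : T).
Hypothesis iotaB : zmod_morphism iota.

Lemma peval_widen (D : {fset nat}) (u : {pmod V}) :
  (msupp u `<=` D)%fset -> peval iota nu u = \sum_(n <- D) nu ^+ n *: iota u@_n.
Proof.
move=> le_uD; apply: big_fset_incl => // n _ /mcoeff_outdom ->.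
by rewrite -[in iota 0](subrr 0) iotaB subrr scaler0.
Qed.

Lemma peval_monomial (v : V) n :
  peval iota nu << v *g n >> = nu ^+ n *: iota v.
Proof. by rewrite (peval_widen msuppU_le) big_seq_fset1 mcoeffU eqxx. Qed.

Lemma peval_const (v : V) : peval iota nu (pmodC v) = iota v.
Proof. by rewrite peval_monomial expr0 scale1r. Qed.

Lemma pevalB : zmod_morphism (peval iota nu).
Proof.
move=> u v; set D := (msupp u `|` msupp v)%fset.
have le_D : (msupp (u - v) `<=` D)%fset.
  by rewrite (fsubset_trans (msuppD_le _ _)) // msuppN.
rewrite (peval_widen le_D) !(@peval_widen D) ?fsubsetUl ?fsubsetUr //.
rewrite -sumrB; apply: eq_bigr => n _.
by rewrite -scalerBr -iotaB mcoeffB.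
Qed.

Lemma pevalN : {morph peval iota nu : u / - u}.
Proof. exact: zmod_morphismN pevalB. Qed.

Lemma pevalD : {morph peval iota nu : u v / u + v}.
Proof. exact: zmod_morphismD pevalB. Qed.

End Evaluation.

(** Reduces identities between evaluations to the case of one monomial, where
    they become identities between powers of the parameter. *)
Lemma eq_on_monomials (V W : zmodType) (F G : {pmod V} -> W) :
  zmod_morphism F -> zmod_morphism G ->
  (forall v n, F << v *g n >> = G << v *g n >>) -> F =1 G.
Proof.
move=> addF addG eqFG u.
rewrite [u]monalgE (zmod_morphism_sum addF) (zmod_morphism_sum addG).
by apply: eq_bigr => n _; apply: eqFG.
Qed.

Section EvaluationTheory.
Variables (T : comNzRingType) (M : lmodType T).

Lemma peval_iotaB (V : zmodType) (iota iota' : V -> M) nu u :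
  peval (fun v => iota v - iota' v) nu u = peval iota nu u - peval iota' nu u.
Proof. by rewrite -sumrB; apply: eq_bigr => n _; rewrite scalerBr. Qed.

Lemma eq_peval (V : zmodType) (iota iota' : V -> M) nu :
  iota =1 iota' -> peval iota nu =1 peval iota' nu.
Proof. by move=> eq_iota u; apply: eq_bigr => n _; rewrite eq_iota. Qed.

Lemma pevalX (S : nzRingType) (V : lmodType S) (iota : V -> M) nu u :
  zmod_morphism iota -> peval iota nu ('X *: u) = nu *: peval iota nu u.
Proof.
move=> iotaB; have addP := pevalB nu iotaB; move: u.
apply: eq_on_monomials => [u v|u v|v n]; rewrite ?scalerBr ?addP ?scalerBr //.
by rewrite pmod_scaleX !peval_monomial // exprS scalerA.
Qed.

Lemma pevalZ (S : nzRingType) (V : lmodType S) (iota : V -> M) nu s t u :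
  zmod_morphism iota -> (forall v, iota (s *: v) = t *: iota v) ->
  peval iota nu (s%:P *: u) = t *: peval iota nu u.
Proof.
move=> iotaB iotaZ; have addP := pevalB nu iotaB; move: u.
apply: eq_on_monomials => [u v|u v|v n]; rewrite ?scalerBr ?addP ?scalerBr //.
by rewrite pmod_scaleC !peval_monomial // iotaZ !scalerA mulrC.
Qed.

(** An additive map that turns multiplication by [nu] into multiplication by
    [rho] turns evaluation at [nu] into evaluation at [rho].  All changes of
    variables below are instances of this. *)
Lemma peval_morph (V : zmodType) (S : nzRingType) (N : lmodType S)
    (iota : V -> N) (E : N -> M) nu rho u :
  zmod_morphism E -> (forall w, E (nu *: w) = rho *: E w) ->
  E (peval iota nu u) = peval (fun v => E (iota v)) rho u.
Proof.
move=> addE EZ.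
rewrite (zmod_morphism_sum addE); apply: eq_bigr => n _ /=.
elim: n (u@_n) => [|n IHn] v; first by rewrite !expr0 !scale1r.
by rewrite !exprS -!scalerA EZ IHn.
Qed.

End EvaluationTheory.

Lemma pmodCB (V : zmodType) : zmod_morphism (@pmodC V).
Proof. by move=> x y; rewrite /pmodC monalgUB. Qed.

(** Lets a product at its own formal parameter be treated as an evaluation. *)
Lemma peval_id (S : comNzRingType) (V : lmodType S) (u : {pmod V}) :
  peval (@pmodC V) ('X : {poly S}) u = u.
Proof.
move: u; apply: eq_on_monomials => [||v n]; first exact: (pevalB _ (@pmodCB V)).
  by [].
by rewrite (peval_monomial _ (@pmodCB V)) pmod_scaleXn.
Qed.

(** * Composites of conformal products at arbitrary spectral parameters *)

Section ConformalProducts.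
Variables (R : realType) (A : lmodType {poly R[i]}).
Implicit Types (f g s : A -> A -> {pmod A}) (a b c : A).
Local Notation Cdl := {poly {poly R[i]}}.
Local Notation Cdlm := {poly Cdl}.
Local Notation d0 := (d0 R).
Local Notation d1 := (d1 R).
Local Notation l1 := (l1 R).
Local Notation l2 := (l2 R).
Local Notation m2 := (m2 R).

Definition opposite g a b : {pmod A} := prod1 g (- d1 - l1) b a.

Lemma commutatorE g a b : commutator g a b = g a b - opposite g a b.
Proof. by []. Qed.

Section Biadditivity.
Variable f : A -> A -> {pmod A}.
Hypothesis conf_f : conformal_algebra f.

Lemma conf_Bl b : zmod_morphism (f^~ b).
Proof.
move=> x y /=; have := conf_linearl conf_f (-1) y x b.
by rewrite !polyCN !scaleN1r ![- _ + _]addrC.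
Qed.

Lemma conf_Br a : zmod_morphism (f a).
Proof.
move=> x y /=; have := conf_linearr conf_f (-1) a y x.
by rewrite !polyCN !scaleN1r ![- _ + _]addrC.
Qed.

End Biadditivity.

Section Opposite.
Variables (T : comNzRingType) (M : lmodType T) (iota : A -> M) (D nu : T).
Hypothesis iotaB : zmod_morphism iota.
Hypothesis iotaD : forall v, iota (d0 *: v) = D *: iota v.

(** The parameter of the opposite product is - d - l; [iota] sends d to [D] and
    evaluation sends l to [nu].  In a composite, [iota] is a product with one
    argument fixed, and sesquilinearity determines [D]. *)
Lemma peval_opposite g a b :
  peval iota nu (opposite g a b) = peval iota (- D - nu) (g b a).
Proof.
rewrite /opposite /prod1.
rewrite (@peval_morph _ _ _ _ _ _ (peval iota nu) _ (- D - nu)).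
- by apply: eq_peval => v; apply: peval_const.
- exact: pevalB.
move=> w; rewrite !scalerBl !scaleNr (pevalB _ iotaB) (pevalN _ iotaB).
by rewrite (pevalX _ _ iotaB) (pevalZ nu w iotaB iotaD).
Qed.

End Opposite.

Local Notation D := (d1%:P : Cdlm).

Lemma const1B : zmod_morphism (@const1 R A).
Proof. exact: pmodCB. Qed.

Lemma const1Z (p : {poly R[i]}) (v : A) : const1 (p *: v) = p%:P *: const1 v.
Proof. by rewrite /const1 /pmodC pmod_scaleC. Qed.

Lemma const2B : zmod_morphism (@const2 R A).
Proof. by move=> x y; rewrite /const2 !pmodCB. Qed.

Lemma const2Z (p : {poly R[i]}) (v : A) : const2 (p *: v) = p%:P%:P *: const2 v.
Proof. by rewrite /const2 /pmodC !pmod_scaleC. Qed.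

Lemma prod1_l1 f a b : prod1 f l1 a b = f a b.
Proof. exact: peval_id. Qed.

Lemma prod1_opposite f nu a b :
  prod1 (opposite f) nu a b = prod1 f (- d1 - nu) b a.
Proof. by apply: peval_opposite; [exact: const1B | exact: const1Z]. Qed.

Lemma prod2_opposite f nu a b :
  prod2 (opposite f) nu a b = prod2 f (- D - nu) b a.
Proof. by apply: peval_opposite; [exact: const2B | exact: const2Z]. Qed.

Lemma prod2_commutator f nu a b :
  prod2 (commutator f) nu a b = prod2 f nu a b - prod2 f (- D - nu) b a.
Proof.
by rewrite -prod2_opposite /prod2 commutatorE (pevalB _ const2B).
Qed.

Section Sesquilinearity.
Variable f : A -> A -> {pmod A}.
Hypothesis conf_f : conformal_algebra f.

Lemma prod2Bl nu b : zmod_morphism (fun a => prod2 f nu a b).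
Proof.
by move=> x y /=; rewrite /prod2 (conf_Bl conf_f) (pevalB _ const2B).
Qed.

Lemma prod2Br nu a : zmod_morphism (prod2 f nu a).
Proof.
by move=> x y /=; rewrite /prod2 (conf_Br conf_f) (pevalB _ const2B).
Qed.

Lemma prod2_derivl nu a b : prod2 f nu (d0 *: a) b = (- nu) *: prod2 f nu a b.
Proof.
rewrite /prod2 (conf_derivl conf_f) (pevalN _ const2B).
by rewrite (pevalX _ _ const2B) scaleNr.
Qed.

Lemma prod2_derivr nu a b :
  prod2 f nu a (d0 *: b) = (D + nu) *: prod2 f nu a b.
Proof.
rewrite /prod2 (conf_derivr conf_f) scalerDl (pevalD _ const2B).
by rewrite (pevalX _ _ const2B) (pevalZ _ _ const2B (const2Z _)) scalerDl.
Qed.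

(** On the product of [b] and [c], right argument of a product at [nu], d acts
    as [D + nu]; the parameter of [c], once it is the left argument, is
    therefore [- (D + nu) - rho]. *)
Lemma prodr_commutator_inner g nu rho a b c :
  prodr f nu (commutator g) rho a b c =
  prodr f nu g rho a b c - prodr f nu g (- D - nu - rho) a c b.
Proof.
rewrite /prodr commutatorE (pevalB _ (prod2Br nu a)).
rewrite (peval_opposite _ (prod2Br nu a) (prod2_derivr nu a)).
by rewrite opprD.
Qed.

(** On the product of [a] and [b], left argument of a product at [rho], d acts
    as [- rho]; the parameter of [b], once it is the left argument, is
    therefore [rho - nu]. *)
Lemma prodl_commutator_inner g nu rho a b c :
  prodl (commutator g) nu f rho a b c =
  prodl g nu f rho a b c - prodl g (rho - nu) f rho b a c.
Proof.
rewrite /prodl commutatorE (pevalB _ (prod2Bl rho c)).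
rewrite (peval_opposite _ (prod2Bl rho c) (D := - rho)) ?opprK //.
by move=> v; rewrite prod2_derivl.
Qed.

End Sesquilinearity.

Lemma prodr_commutator_outer f g nu rho a b c :
  prodr (commutator f) nu g rho a b c =
  prodr f nu g rho a b c - prodl g rho f (- D - nu) b c a.
Proof.
rewrite /prodr /prodl -peval_iotaB.
by apply: eq_peval => w; apply: prod2_commutator.
Qed.

Lemma prodl_commutator_outer f g nu rho a b c :
  prodl f nu (commutator g) rho a b c =
  prodl f nu g rho a b c - prodr g (- D - rho) f nu c a b.
Proof.
rewrite /prodr /prodl -peval_iotaB.
by apply: eq_peval => w; apply: prod2_commutator.
Qed.

Section Commutativity.
Variable f : A -> A -> {pmod A}.
Hypothesis comm_f : forall a b, f a b = opposite f a b.

Lemma prodl_comm_outer g nu rho a b c :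
  prodl g nu f rho a b c = prodr f (- D - rho) g nu c a b.
Proof.
apply: eq_peval => w.
by rewrite -prod2_opposite /prod2 -comm_f.
Qed.

Lemma prodr_comm_inner g nu rho a b c : conformal_algebra g ->
  prodr g nu f rho a b c = prodr g nu f (- D - nu - rho) a c b.
Proof.
move=> conf_g; rewrite /prodr comm_f.
rewrite (peval_opposite _ (prod2Br conf_g nu a) (prod2_derivr conf_g nu a)).
by rewrite opprD.
Qed.

End Commutativity.

(** * Substitution into identities between composites *)

(** The inner variable l goes to [sigma], the outer variable m to [tau], and
    d is kept: this is semilinear over the endomorphism of C[d][l][m] with these
    values, and it fixes constants, so it changes only the parameters of a
    composite. *)
Definition subst2 (sigma tau : Cdlm) (w : {pmod {pmod A}}) : {pmod {pmod A}} :=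
  peval (peval (@const2 R A) sigma) tau w.

Section Substitution.
Variables sigma tau : Cdlm.
Local Notation ev := (subst2 sigma tau).

Lemma subst2B : zmod_morphism ev.
Proof. exact: pevalB (pevalB _ const2B). Qed.

Lemma subst2D : {morph ev : u v / u + v}.
Proof. exact: pevalD (pevalB _ const2B). Qed.

Lemma subst2_m2 w : ev (m2 *: w) = tau *: ev w.
Proof. exact: pevalX (pevalB _ const2B). Qed.

Lemma subst2_l2 w : ev (l2 *: w) = sigma *: ev w.
Proof.
apply: pevalZ (pevalB _ const2B) _ => v.
exact: pevalX const2B.
Qed.

Lemma subst2_lm w : ev ((l2 + m2) *: w) = (sigma + tau) *: ev w.
Proof. by rewrite scalerDl subst2D subst2_l2 subst2_m2 scalerDl. Qed.

Lemma subst2_const v : ev (const2 v) = const2 v.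
Proof.
rewrite /subst2 !peval_const //; first exact: const2B.
exact: pevalB const2B.
Qed.

Lemma subst2_prod2 f nu nu' a b : (forall w, ev (nu *: w) = nu' *: ev w) ->
  ev (prod2 f nu a b) = prod2 f nu' a b.
Proof.
move=> evnu; rewrite /prod2 (peval_morph _ _ subst2B evnu).
by apply: eq_peval => v; apply: subst2_const.
Qed.

Lemma subst2_prodr f g nu nu' rho rho' a b c :
  (forall w, ev (nu *: w) = nu' *: ev w) ->
  (forall w, ev (rho *: w) = rho' *: ev w) ->
  ev (prodr f nu g rho a b c) = prodr f nu' g rho' a b c.
Proof.
move=> evnu evrho; rewrite /prodr (peval_morph _ _ subst2B evrho).
by apply: eq_peval => v; apply: subst2_prod2.
Qed.

Lemma subst2_prodl f g nu nu' rho rho' a b c :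
  (forall w, ev (nu *: w) = nu' *: ev w) ->
  (forall w, ev (rho *: w) = rho' *: ev w) ->
  ev (prodl f nu g rho a b c) = prodl f nu' g rho' a b c.
Proof.
move=> evnu evrho; rewrite /prodl (peval_morph _ _ subst2B evnu).
by apply: eq_peval => v; apply: subst2_prod2.
Qed.

(** For [f = g] this is left-symmetry; with [f] left-symmetric and [g]
    commutative it is the second compatibility axiom. *)
Lemma leftsym_subst f g a b c :
  prodl f l2 g (l2 + m2) a b c - prodr f l2 g m2 a b c =
    prodl f m2 g (l2 + m2) b a c - prodr f m2 g l2 b a c ->
  prodl f sigma g (sigma + tau) a b c - prodr f sigma g tau a b c =
    prodl f tau g (sigma + tau) b a c - prodr f tau g sigma b a c.
Proof.
move=> E; rewrite -(subst2_prodl f g a b c subst2_l2 subst2_lm).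
rewrite -(subst2_prodr f g a b c subst2_l2 subst2_m2).
rewrite -(subst2_prodl f g b a c subst2_m2 subst2_lm).
rewrite -(subst2_prodr f g b a c subst2_m2 subst2_l2).
exact: etrans (esym (subst2B _ _)) (etrans (congr1 ev E) (subst2B _ _)).
Qed.

Lemma mixed_subst f g a b c :
  prodl f l2 g (l2 + m2) a b c = prodr f l2 g m2 a b c ->
  prodl f sigma g (sigma + tau) a b c = prodr f sigma g tau a b c.
Proof.
move=> E; rewrite -(subst2_prodl f g a b c subst2_l2 subst2_lm).
by rewrite -(subst2_prodr f g a b c subst2_l2 subst2_m2) E.
Qed.

End Substitution.

(** * The commutator product *)

Lemma conformal_commutator g :
  conformal_algebra g -> conformal_algebra (commutator g).
Proof.
move=> conf_g.
have evB nu := pevalB nu const1B; have evD nu := pevalD nu const1B.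
have evN nu := pevalN nu const1B.
have evZ nu p u : peval (@const1 R A) nu (p%:P *: u)
    = p%:P *: peval (@const1 R A) nu u.
  exact: (pevalZ _ _ const1B (const1Z p)).
have evX nu u : peval (@const1 R A) nu (l1 *: u)
    = nu *: peval (@const1 R A) nu u by exact: (pevalX _ _ const1B).
split=> [k a a' b|k a b b'|a b|a b]; rewrite /commutator /prod1.
- rewrite (conf_linearl conf_g) (conf_linearr conf_g) evD evZ.
  by rewrite opprD scalerBr addrACA.
- rewrite (conf_linearl conf_g) (conf_linearr conf_g) evD evZ.
  by rewrite opprD scalerBr addrACA.
- rewrite (conf_derivl conf_g) (conf_derivr conf_g) scalerDl evD evZ evX.
  by rewrite -scalerDl addNKr scaleNr scalerBr opprB opprK addrC.
- rewrite (conf_derivl conf_g) (conf_derivr conf_g) evN evX.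
  by rewrite -opprD scaleNr opprK scalerBr.
Qed.

Lemma commutator_skew g a b :
  commutator g a b = - prod1 (commutator g) (- l1 - d1) b a.
Proof.
have -> nu : prod1 (commutator g) nu b a =
             prod1 g nu b a - prod1 g (- d1 - nu) a b.
  by rewrite -prod1_opposite /prod1 commutatorE (pevalB _ const1B).
by rewrite opprB opprB opprK addKr prod1_l1 [- l1 - d1]addrC.
Qed.

Lemma commutator_jacobi s nu rho a b c :
  left_symmetric_conformal_algebra s ->
  let br := commutator s in
  prodr br nu br rho a b c =
    prodl br nu br (nu + rho) a b c + prodr br rho br nu b a c.
Proof.
case=> conf_s ls br; rewrite /br {br}.
(* [nu], [rho] and [k] are the parameters of [a], [b] and [c]. *)
set k := - D - nu - rho.
rewrite !(prodr_commutator_outer, prodl_commutator_outer).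
rewrite !(prodr_commutator_inner conf_s, prodl_commutator_inner conf_s).
have -> : - D - rho - nu = k by rewrite /k; ring.
have -> : - D - (nu + rho) = k by rewrite /k; ring.
have -> : - D - nu = rho + k by rewrite /k; ring.
have -> : - D - rho = nu + k by rewrite /k; ring.
have -> : - D - k - nu = rho by rewrite /k; ring.
have addKl (x y : Cdlm) : x + y - x = y by rewrite addrAC subrr add0r.
rewrite !addKl.
exact: associator_cancel (leftsym_subst nu rho (ls a b c))
  (leftsym_subst nu k (ls a c b)) (leftsym_subst rho k (ls b c a)).
Qed.

Lemma transposed_Poisson_compat_commutator f s nu rho a b c :
  preLie_Poisson_conformal_algebra f s ->
  prodr f nu (commutator s) rho a b c *+ 2 =
    prodl f nu (commutator s) (nu + rho) a b c
    + prodr (commutator s) rho f nu b a c.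
Proof.
case=> [[conf_f _ comm_f] [conf_s _] mixed compat].
set k := - D - nu - rho.
rewrite (prodr_commutator_inner conf_f) prodl_commutator_outer.
rewrite prodr_commutator_outer.
have -> : - D - (nu + rho) = k by rewrite /k; ring.
have -> : - D - rho = nu + k by rewrite /k; ring.
rewrite (mixed_subst nu rho (mixed a b c)) (mixed_subst nu k (mixed a c b)).
have := leftsym_subst rho k (compat b c a).
rewrite !(prodl_comm_outer comm_f s).
have -> : - D - (rho + k) = nu by rewrite /k; ring.
rewrite (prodr_comm_inner comm_f rho k b c a conf_s).
rewrite (prodr_comm_inner comm_f k rho c b a conf_s).
have -> : - D - rho - k = nu by rewrite /k; ring.
have -> : - D - k - rho = nu by rewrite /k; ring.
exact: double_cancel.
Qed.

End ConformalProducts.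

Theorem proposition4p11 (R : realType) (L : lmodType {poly R[i]%C})
    (circ star : L -> L -> {pmod L}) :
  preLie_Poisson_conformal_algebra circ star ->
  transposed_Poisson_conformal_algebra circ (commutator star).
Proof.
move=> plp; case: (plp) => ca ls _ _; split; first exact: ca.
  split=> [||a b c]; last exact: commutator_jacobi.
    exact: conformal_commutator (ls_conformal ls).
  exact: commutator_skew.
by move=> a b c; apply: transposed_Poisson_compat_commutator.
Qed.
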